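(* Let $p, r$ be positive integers with $p$ prime. Define $$l_r = \min_l \left\{ l : l + \frac{l-\sigma_p(l)}{p-1} \ge r \right\},$$ where $l$ ranges over the non-negative integers. Then $r \ge l_r$, and the sequence $K(n) \bmod p^r$, $n\ge 0$, is constant for $n \ge l_r\, p$.
   Context: Kurepa's left factorial function is defined by $K(0)=0$ and $K(n)=\sum_{k=0}^{n-1} k!$ for $n\ge 1$. $\sigma_p(l)$ denotes the sum of the digits of $l$ in base $p$. *)

(* Defs.v *)
From mathcomp Require Import all_boot all_order all_algebra.

Set Implicit Arguments.
Unset Strict Implicit.
Unset Printing Implicit Defensive.

Import Order.TTheory GRing.Theory Num.Theory.

(** Kurepa's left factorial; the empty sum gives [kurepa 0 = 0]. *)
Definition kurepa (n : nat) : nat := \sum_(k < n) k`!.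

(** [(l %/ p ^ i) %% p] is the digit of [p ^ i] in the base-[p] expansion of
    [l].  When [1 < p], all digits of index [i > l] vanish, since [l < p ^ l],
    so the bound [i < l.+1] loses nothing. *)
Definition digit_sum (p l : nat) : nat := \sum_(i < l.+1) (l %/ p ^ i) %% p.

(** The inequality is stated in [rat], so that neither the subtractions nor the
    division are truncated. *)
Definition lr_cond (p r l : nat) : bool :=
  (r%:R <= l%:R + (l%:R - (digit_sum p l)%:R) / (p%:R - 1) :> rat)%R.

Lemma digit_sum0 (l : nat) : digit_sum 0 l = l.
Proof.
rewrite /digit_sum big_ord_recl expn0 divn1 modn0 big1 ?addn0 // => i _.
by rewrite lift0 exp0n // divn0 mod0n.
Qed.

Lemma digit_sum_le (p l : nat) : digit_sum p l <= l.
Proof.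
case: p => [|p]; first by rewrite digit_sum0.
suff H m : \sum_(i < m) (l %/ p.+1 ^ i) %% p.+1 + l %/ p.+1 ^ m <= l.
  exact: leq_trans (leq_addr _ _) (H l.+1).
elim: m => [|m IHm]; first by rewrite big_ord0 expn0 divn1.
apply: leq_trans IHm; rewrite big_ord_recr /= -addnA leq_add2l.
rewrite expnSr divnMA addnC {3}(divn_eq (l %/ p.+1 ^ m) p.+1) leq_add2r.
exact: leq_pmulr.
Qed.

(** Beware that [p = 0] makes the denominator negative, hence the split. *)
Lemma lr_cond_self (p r : nat) : lr_cond p r r.
Proof.
rewrite /lr_cond lerDl; case: p => [|p].
  by rewrite digit_sum0 subrr mul0r.
rewrite -[in X in (_ / (X - _))%R]natr1 addrK.
by rewrite mulr_ge0 ?invr_ge0 ?ler0n // subr_ge0 ler_nat digit_sum_le.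
Qed.

Lemma lr_cond_ex (p r : nat) : exists l, lr_cond p r l.
Proof. by exists r; apply: lr_cond_self. Qed.

Definition lr (p r : nat) : nat := ex_minn (lr_cond_ex p r).

(* Main.v *)
Require Import Defs.
From mathcomp Require Import all_boot all_order all_algebra.

(** By Legendre's formula [(l - digit_sum p l) / (p - 1)] is the [p]-adic
    valuation of [l!], and [p ^ l * l!] divides [(l * p)!]; so the condition
    defining [lr p r] makes [p ^ r] divide [k!] for every [k >= lr p r * p], and
    such terms do not change the left factorial modulo [p ^ r]. *)

Import GRing.Theory Num.Theory.

Lemma dvdn_fact_fact {m n : nat} : m <= n -> m`! %| n`!.
Proof.
move=> /subnKC <-; elim: (n - m) => [|k IHk]; first by rewrite addn0.
by rewrite addnS factS dvdn_mull.
Qed.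

(** Among the factors that each step of the induction adds, the top one, [l.+1 * p.+1], already
    supplies the new [p.+1] and [l.+1]. *)
Lemma expn_fact_dvd_fact_mul (p l : nat) : 0 < p -> p ^ l * l`! %| (l * p)`!.
Proof.
case: p => // p _; elim: l => [|l IHl]; first by rewrite mul1n.
rewrite mulSn addSn factS -addSn -mulSn expnS factS mulnACA (mulnC p.+1).
by apply/dvdn_mul/(dvdn_trans IHl)/dvdn_fact_fact/leq_addl.
Qed.

Lemma digit_sum_logn_fact (p l : nat) : prime p ->
  digit_sum p l + p.-1 * logn p l`! = l.
Proof.
move=> p_prime; have p_gt1 := prime_gt1 p_prime.
(* Each digit is [l %/ p ^ i] minus [p] times the next quotient, so a partial sum leaves only the
   quotient at [m]. *)
have telescope m : \sum_(i < m) (l %/ p ^ i) %% p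
    + p.-1 * \sum_(1 <= k < m.+1) l %/ p ^ k + l %/ p ^ m = l.
  elim: m => [|m IHm]; first by rewrite big_ord0 big_geq // muln0 divn1.
  rewrite -[RHS]IHm big_ord_recr /= big_nat_recr //= mulnDr addnACA -!addnA.
  do 2!congr (_ + _); rewrite -mulSnr prednK ?prime_gt0 // expnSr divnMA addnC mulnC.
  by rewrite -divn_eq.
have quot0 : l %/ p ^ l = 0 by apply: divn_small; apply: ltn_expl.
(* At [m = l] the leftover quotient vanishes, and so does the last digit of [digit_sum]. *)
rewrite logn_fact // /digit_sum big_ord_recr /= quot0 mod0n addn0.
by rewrite -[RHS](telescope l) quot0 addn0.
Qed.

(** Legendre's formula turns the numerator into a multiple of [p - 1], so the rational division is
    exact. *)
Lemma lr_condE (p r l : nat) : prime p ->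
  lr_cond p r l = (r <= l + logn p l`!).
Proof.
move=> p_prime; rewrite /lr_cond -{2}(digit_sum_logn_fact _ l p_prime).
have p1_neq0 : (p%:R - 1 != 0 :> rat)%R.
  by rewrite subr_eq0 pnatr_eq1 neq_ltn prime_gt1 ?orbT.
rewrite natrD addrAC subrr add0r natrM -subn1 natrB ?prime_gt0 //.
by rewrite mulrAC mulfV // mul1r -natrD ler_nat.
Qed.

Lemma kurepa_mod_const (d N n : nat) :
  (forall k, N <= k -> d %| k`!) -> N <= n -> kurepa n = kurepa N %[mod d].
Proof.
move=> d_dvd /subnKC <-; elim: (n - N) => [|k IHk]; first by rewrite addn0.
rewrite addnS /kurepa big_ord_recr /= -modnDmr.
by rewrite (eqP (d_dvd _ (leq_addr _ _))) addn0.
Qed.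

Theorem theorem3p3 (p r : nat) (p_prime : prime p) (r_gt0 : 0 < r) :
  lr p r <= r /\
  (forall m n : nat, lr p r * p <= m -> lr p r * p <= n ->
     kurepa m = kurepa n %[mod p ^ r]).
Proof.
rewrite /lr; case: ex_minnP => l; rewrite lr_condE // => r_le l_min.
split=> [|m n le_m le_n]; first exact: l_min (lr_cond_self p r).
have dvd_fact k : l * p <= k -> p ^ r %| k`!.
  move=> le_k; apply: dvdn_trans (dvdn_fact_fact le_k).
  apply: dvdn_trans (expn_fact_dvd_fact_mul _ _ (prime_gt0 p_prime)).
  (* Split [p ^ (l + logn p l!)]: the second power divides [l!]. *)
  rewrite (dvdn_trans (dvdn_exp2l p r_le)) // expnD dvdn_mul //.
  exact: pfactor_dvdnn.
by rewrite !(kurepa_mod_const _ _ _ dvd_fact).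
Qed.
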